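(* Let $d\geq 2$ be an integer. For every deterministic online coloring algorithm $\mathcal{A}$ and every integer $n\geq 2d^2$, there exists an $n$-vertex chordal graph $G$ with chromatic number $\chi(G)=d$ (together with an order of presentation of its vertices) such that $\mathcal{A}$ uses $\Omega(d\cdot\log n)$ colors to color $G$, where the implicit constant is absolute (independent of $d$, $n$ and $\mathcal{A}$).
   Context: Online graph coloring: the vertices of a graph $G=(V,E)$ arrive one at a time in an order $v_1,\dots,v_n$ chosen by an adversary; when $v_t$ arrives, its edges to the earlier vertices $v_s$, $s<t$, are revealed, and the algorithm must immediately and irrevocably assign to $v_t$ a color different from the colors of its already-presented neighbors. The number of colors used by $\mathcal{A}$ on $G$ is the number of distinct colors it assigns. A graph is chordal if every induced cycle on four or more vertices has a chord. Logarithms are base 2. *)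

(* Defs.v *)
From mathcomp Require Import all_boot all_order all_fingroup all_algebra.
From mathcomp Require Import reals exp.

Set Implicit Arguments.
Unset Strict Implicit.
Unset Printing Implicit Defensive.

Record sgraph (V : finType) := SGraph {
  adj :> rel V;
  adj_sym : symmetric adj;
  adj_irr : irreflexive adj
}.

Definition colorable (V : finType) (G : sgraph V) (k : nat) : bool :=
  [exists f : {ffun V -> 'I_k}, [forall x, forall y, G x y ==> (f x != f y)]].

Lemma colorable_ex (V : finType) (G : sgraph V) : exists k, colorable G k.
Proof.
exists #|V|; apply/existsP; exists [ffun x => enum_rank x].
apply/forallP=> x; apply/forallP=> y; apply/implyP=> xy.
rewrite !ffunE; apply: contraTneq xy => /enum_rank_inj ->.
by rewrite adj_irr.
Qed.

Definition chi (V : finType) (G : sgraph V) : nat := ex_minn (colorable_ex G).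

(* A chord joins two vertices of the cycle that are not consecutive on it. *)
Definition chordal (V : finType) (G : sgraph V) : Prop :=
  forall c : seq V, 4 <= size c -> ucycle G c ->
  exists x y : V,
    [/\ x \in c, y \in c, G x y, y != next c x & x != next c y].

(* The order of presentation is a permutation [v] of the vertices: [v t] is the
   vertex that arrives at time [t]. *)
Section Presentation.
Variables (n : nat) (G : sgraph 'I_n) (v : 'S_n).

(* Arrival times, in increasing order, of the earlier neighbors of [v t]. *)
Definition revealed (t : 'I_n) : seq nat :=
  [seq (s : nat) | s : 'I_n <- enum 'I_n & (s < t) && G (v s) (v t)].

Definition history (t : 'I_n) : seq (seq nat) :=
  [seq revealed s | s : 'I_n <- enum 'I_n & s <= t].

End Presentation.

(* The color given to [v t] is a function of everything revealed up to and
   including time [t].  The colors given earlier are themselves determined by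
   this data, so they need not be passed as a separate argument. *)
Record online_algorithm := OnlineAlgorithm {
  answer :> seq (seq nat) -> nat;
  answer_proper : forall (n : nat) (G : sgraph 'I_n) (v : 'S_n) (s t : 'I_n),
    s < t -> G (v s) (v t) ->
    answer (history G v t) != answer (history G v s)
}.

Definition colors_used (A : online_algorithm) (n : nat) (G : sgraph 'I_n)
    (v : 'S_n) : nat :=
  size (undup [seq A (history G v t) | t <- enum 'I_n]).

Definition log2 (R : realType) (x : R) : R := (ln x / ln 2)%R.

(* Main.v *)
Require Import Defs.
From mathcomp Require Import all_boot all_order all_fingroup all_algebra.
From mathcomp Require Import reals exp zify.

Set Implicit Arguments.
Unset Strict Implicit.
Unset Printing Implicit Defensive.

Import Order.TTheory GRing.Theory Num.Theory.

(** Let h = 2g - 1 with 2h <= d.  By induction on k the adversary forces g k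
    distinct colors on a set X of vertices to which a whole clique of size h can
    still be joined, using at most h (2^k - 1) vertices.  For the step it plays
    the strategy for k twice, obtaining X1 and X2 in disjoint parts of the graph.
    If X1 and X2 together carry g (k + 1) colors it keeps their union.  Otherwise
    fewer than g colors of X1 are missing from X2, so a clique Q of size h joined
    to all of X2, which avoids the colors of X2, repeats at most g - 1 colors of
    X1; then X1 and Q together carry g (k + 1) colors.  With g about d/4 and
    2^k about n/d this gives order d log n colors, since n >= 2d^2 makes log(n/d)
    comparable to log n.  A disjoint d-clique and isolated vertices fill up the
    n vertices. *)

(** * Adversary graphs on the naturals and the run of the algorithm on them *)

(* Only the values [e s t] with [s < t] matter: [e ^~ t] is what vertex [t]
   reveals on arrival. *)
Definition symadj (e : rel nat) : rel nat :=
  fun x y => (x < y) && e x y || (y < x) && e y x.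

Lemma symadj_sym e : symmetric (symadj e).
Proof. by move=> x y; rewrite /symadj orbC. Qed.

Lemma symadj_irr e : irreflexive (symadj e).
Proof. by move=> x; rewrite /symadj ltnn. Qed.

Lemma symadj_lt e x y : x < y -> symadj e x y = e x y.
Proof. by move=> lt_xy; rewrite /symadj lt_xy ltnNge (ltnW lt_xy) orbF. Qed.

(** [e'] continues the play [e] after time [n]: nothing already revealed changes, so colors given
    before [n] stay fixed. *)
Definition agree (n : nat) (e e' : rel nat) :=
  forall x y, x < y -> y < n -> e' x y = e x y.

Lemma agree_trans m n e1 e2 e3 :
  m <= n -> agree m e1 e2 -> agree n e2 e3 -> agree m e1 e3.
Proof.
move=> le_mn e12 e23 x y xy ym.
by rewrite e23 ?(leq_trans ym) // e12.
Qed.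

Lemma agree_symadj n e e' x y :
  agree n e e' -> x < n -> y < n -> symadj e' x y = symadj e x y.
Proof.
move=> ee' xn yn; rewrite /symadj.
by case: (ltngtP x y) => //= xy; rewrite ?orbF ee'.
Qed.

Definition graph_of (e : rel nat) (n : nat) : sgraph 'I_n :=
  @SGraph 'I_n (fun x y => symadj e x y)
    (fun x y => symadj_sym e x y) (fun x => symadj_irr e x).

Definition rows (e : rel nat) (n : nat) : seq (seq nat) :=
  mkseq (fun t => [seq s <- iota 0 t | e s t]) n.

Lemma agree_rows m n e e' : agree n e e' -> m <= n -> rows e' m = rows e m.
Proof.
move=> ee' mn; apply/eq_in_map => t; rewrite mem_iota /= => tm.
apply/eq_in_filter => s; rewrite mem_iota /= => st.
by rewrite ee' // (leq_trans tm).
Qed.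

Lemma filter_iota_lt m n (P : pred nat) : m <= n ->
  [seq s <- iota 0 n | (s < m) && P s] = [seq s <- iota 0 m | P s].
Proof.
move=> le_mn; rewrite -(subnKC le_mn) iotaD filter_cat.
rewrite [X in _ ++ X](_ : _ = [::]) ?cats0.
  by apply/eq_in_filter => s; rewrite mem_iota add0n => /= ->.
apply/eqP; rewrite -[_ == _]negbK -has_filter; apply/hasPn => s.
by rewrite mem_iota add0n => /andP[ms _]; rewrite ltnNge ms.
Qed.

(** Under the identity order the history does not mention [n], so colors are defined before the size
    of the final graph is known. *)
Lemma history_graph_of e n (t : 'I_n) :
  history (graph_of e n) 1 t = rows e t.+1.
Proof.
have rev (s : 'I_n) : revealed (graph_of e n) 1 s = [seq x <- iota 0 s | e x s].
  rewrite -(filter_iota_lt _ (ltnW (ltn_ord s))) -val_enum_ord filter_map.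
  rewrite /revealed; congr map; apply: eq_filter => x /=; rewrite !perm1.
  by case: ltnP => //= xs; rewrite symadj_lt.
rewrite /history (eq_map rev) /rows /mkseq.
rewrite (map_comp (fun s => [seq x <- iota 0 s | e x s]) val); congr map.
rewrite -[iota 0 t.+1](filter_predT) -(filter_iota_lt _ (ltn_ord t)).
rewrite -val_enum_ord filter_map; congr map; apply: eq_filter => x /=.
by rewrite andbT ltnS.
Qed.

Definition col (A : online_algorithm) (e : rel nat) (t : nat) : nat :=
  A (rows e t.+1).

Lemma agree_col A n e e' t : agree n e e' -> t < n -> col A e' t = col A e t.
Proof. by move=> ee' tn; rewrite /col (agree_rows ee'). Qed.

Lemma agree_map_col A n e e' X : agree n e e' -> {in X, forall x, x < n} ->
  map (col A e') X = map (col A e) X.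
Proof. by move=> ee' Xn; apply/eq_in_map => x /Xn; apply: agree_col. Qed.

Lemma col_proper A e x y : symadj e x y -> col A e x != col A e y.
Proof.
wlog lt_xy : x y / x < y => [IH|].
  case: (ltngtP x y) => [/IH //|yx|->]; last by rewrite symadj_irr.
  by rewrite symadj_sym eq_sym; apply: IH.
move=> exy; rewrite eq_sym.
have := @answer_proper A y.+1 (graph_of e y.+1) 1
  (Ordinal (ltnW lt_xy : x < y.+1)) (Ordinal (ltnSn y)) lt_xy.
by rewrite !history_graph_of /= !perm1; apply.
Qed.

Lemma leq_colors_used A e n X : {in X, forall x, x < n} ->
  size (undup (map (col A e) X)) <= colors_used A (graph_of e n) 1.
Proof.
move=> Xn; apply: uniq_leq_size (undup_uniq _) _ => k; rewrite !mem_undup.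
case/mapP => x xX ->; apply/mapP; exists (Ordinal (Xn x xX)).
  by rewrite mem_enum.
by rewrite history_graph_of.
Qed.

(** * Chordality from elimination orderings *)

Lemma exists_max_rank (T : eqType) (r : T -> nat) (s : seq T) : s != [::] ->
  exists2 x, x \in s & {in s, forall y, r y <= r x}.
Proof.
elim: s => // a [|b s] IH _; first by exists a => [|y]; rewrite inE // => /eqP->.
have [//|x xs xmax] := IH.
case: (leqP (r a) (r x)) => ax.
  exists x => [|y]; first by rewrite inE xs orbT.
  by rewrite inE => /orP[/eqP-> //|/xmax].
exists a => [|y]; first exact: mem_head.
by rewrite inE => /orP[/eqP-> //|/xmax /leq_trans -> //]; apply: ltnW.
Qed.

(* On a cycle, the two neighbors of a vertex of maximal rank span a chord. *)
Lemma perfect_elimination_chordal (V : finType) (G : sgraph V) (r : V -> nat) :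
  (forall x y, G x y -> r x != r y) ->
  (forall x y z, G y x -> G z x -> r y < r x -> r z < r x -> y != z -> G y z) ->
  chordal G.
Proof.
move=> rne peo c c4 Gc.
have Uc : uniq c by case/andP: Gc.
have [|x xc xmax] := @exists_max_rank _ r c; first by case: c c4 {Gc Uc}.
have [i p cE] := rot_to xc.
have := Gc; rewrite -(rot_ucycle i) cE => Gxp.
have : size (x :: p) = size c by rewrite -cE size_rot.
have memE : x :: p =i c by move=> y; rewrite -cE mem_rot.
have nextE := next_rot i Uc; rewrite cE in nextE.
move: {cE} p Gxp memE nextE => [|y [|w q]]; try by move=> /= *; lia.
(* Length at least four puts [w] strictly between the two neighbors [y] and [z] of [x], so [y] and
   [z] are not consecutive. *)
case/lastP: q => [|q z] Gp memE nextE sz; first by move: c4; rewrite -sz.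
have [yc zc] : y \in c /\ z \in c.
  by rewrite -!memE !inE !mem_rcons !inE !eqxx !orbT.
case/andP: Gp => /=; rewrite rcons_path last_rcons => /and4P[xy _ _ zx] U.
have {U} [xNz yNz wNz] : [/\ x != z, y != z & w != z].
  move: U; rewrite !inE !mem_rcons !inE.
  by case: (x == z); case: (y == z); case: (w == z); rewrite /= ?orbT ?andbF.
have lt_rank u : u \in c -> G u x -> r u < r x.
  by move=> uc ux; rewrite ltn_neqAle rne // xmax.
exists y, z; split=> //.
- by apply: (peo x) yNz; rewrite ?lt_rank // adj_sym.
- rewrite -nextE /= eqxx.
  by case: (y =P x) xy => [->|_ _]; rewrite ?adj_irr // eq_sym.
- apply: contra_neq xNz => yE; apply: (can_inj (prev_next Uc)).
  by rewrite -yE -nextE /= eqxx.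
Qed.

(** Fewer than [g] values of [s1] lie outside [s2], and only those can recur in [q]; at least [g] of
    the [2g - 1] entries of [q] are new. *)
Lemma leq_size_undup_cat_disjoint (T : eqType) (s1 s2 q : seq T) m g :
  uniq q -> {in q, forall x, x \notin s2} -> g.*2 <= (size q).+1 ->
  m <= size (undup s1) -> m <= size (undup s2) ->
  size (undup (s1 ++ s2)) < m + g -> m + g <= size (undup (s1 ++ q)).
Proof.
move=> Uq qs2 gq m1 m2; rewrite !undup_cat !size_cat !size_filter.
rewrite (undup_id Uq) => lt_mg.
have E : count (fun x => x \in q) (undup s1) +
    count (fun x => x \notin q) (undup s1) = size (undup s1).
  exact: count_predC.
have le_qs : count (fun x => x \in q) (undup s1) <=
    count (fun x => x \notin s2) (undup s1).
  by apply: sub_count => x /= /qs2.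
lia.
Qed.

(** * Blocks, their unions and the joining of a clique *)

Section Blocks.
Variables d h : nat.

(* Vertices [a, b) of [e], not adjacent to anything before [a], with a proper
   [d]-coloring [c] and a ranking [r] that is the reverse of a perfect
   elimination ordering.  [X] collects the vertices that later cliques of size
   [h] may be joined to: it is an initial segment for [r] along edges, which is
   what preserves the ordering, and has colors below [h], which leaves room for
   the new clique. *)
Record block (e : rel nat) (a b : nat) (X : seq nat) (c r : nat -> nat) := Block {
  block_le : a <= b;
  block_sep : forall x y, x < a -> a <= y < b -> ~~ symadj e x y;
  block_bound : forall x, a <= x < b -> c x < d;
  block_proper : forall x y, a <= x < b -> a <= y < b ->
    symadj e x y -> c x != c y;
  block_rank : forall x y, a <= x < b -> a <= y < b ->
    symadj e x y -> r x != r y;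
  block_peo : forall x y z, a <= x < b -> a <= y < b -> a <= z < b ->
    symadj e y x -> symadj e z x -> r y < r x -> r z < r x -> y != z ->
    symadj e y z;
  block_sub : forall x, x \in X -> a <= x < b;
  block_small : forall x, x \in X -> c x < h;
  block_initial : forall x y, x \in X -> a <= y < b ->
    symadj e y x -> r y < r x -> y \in X
}.

Lemma block_empty e a : block e a a [::] id id.
Proof. by split=> // *; lia. Qed.

Lemma block_agree e e' a b X c r :
  agree b e e' -> block e a b X c r -> block e' a b X c r.
Proof.
move=> ee' [le sep bd pr rk peo sub sm ini].
have E x y : x < b -> y < b -> symadj e' x y = symadj e x y.
  exact: agree_symadj.
split=> //.
- by move=> x y xa yab; rewrite E ?sep //; lia.
- by move=> x y xab yab; rewrite E; [exact: pr|lia|lia].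
- by move=> x y xab yab; rewrite E; [exact: rk|lia|lia].
- by move=> x y z xab yab zab; rewrite !E; [exact: peo|lia..].
- move=> x y xX yab; have xab := sub x xX.
  by rewrite E; [exact: ini|lia|lia].
Qed.

(** No edge crosses [b], by [block_sep] of the second block, so colorings and rankings glue without
    any compatibility condition. *)
Lemma block_cat e a b b' X1 X2 c1 c2 r1 r2 :
  block e a b X1 c1 r1 -> block e b b' X2 c2 r2 ->
  block e a b' (X1 ++ X2) (fun x => if x < b then c1 x else c2 x)
    (fun x => if x < b then r1 x else r2 x).
Proof.
move=> [le1 sep1 bd1 pr1 rk1 peo1 sub1 sm1 ini1].
move=> [le2 sep2 bd2 pr2 rk2 peo2 sub2 sm2 ini2].
have side x y : a <= x < b' -> a <= y < b' -> symadj e x y -> (y < b) = (x < b).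
  move=> xab yab xy; case: (ltnP x b) => xb; case: (ltnP y b) => // yb.
    by have /negP[] : ~~ symadj e x y by apply: sep2; lia.
  by have /negP[] : ~~ symadj e y x by [apply: sep2; lia]; rewrite symadj_sym.
split.
- exact: leq_trans le2.
- move=> x y xa yab; case: (ltnP y b) => yb; first by apply: sep1; lia.
  by apply: sep2; lia.
- by move=> x xab; case: (ltnP x b) => xb; [apply: bd1|apply: bd2]; lia.
- move=> x y xab yab xy; rewrite (side x y) //.
  have := side x y xab yab xy.
  by case: (ltnP x b) => xb yb; [apply: pr1|apply: pr2] => //; lia.
- move=> x y xab yab xy; rewrite (side x y) //.
  have := side x y xab yab xy.
  by case: (ltnP x b) => xb yb; [apply: rk1|apply: rk2] => //; lia.
- move=> x y z xab yab zab yx zx.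
  have sy := side _ _ yab xab yx; have sz := side _ _ zab xab zx.
  rewrite -sy -sz; case: (ltnP x b) sy sz => xb sy sz ry rz yz.
    by apply: (peo1 x) => //; lia.
  by apply: (peo2 x) => //; lia.
- by move=> x; rewrite mem_cat => /orP[/sub1|/sub2]; lia.
- move=> x; rewrite mem_cat => /orP[xX|xX].
    by have /andP[_ ->] := sub1 x xX; apply: sm1.
  by have /andP[] := sub2 x xX; rewrite leqNgt => /negbTE-> _; apply: sm2.
- move=> x y; rewrite !mem_cat => xX yab yx.
  have xab : a <= x < b' by case/orP: xX => [/sub1|/sub2]; lia.
  have := side _ _ yab xab yx.
  case: (ltnP x b) => xb yb; rewrite -yb => ry.
    case/orP: xX => [xX|/sub2]; last by lia.
    by rewrite (ini1 x) //; lia.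
  case/orP: xX => [/sub1|xX]; first by lia.
  by rewrite (ini2 x) ?orbT //; lia.
Qed.

(** The clique has no upper end; the interval of the block cuts it to [h] vertices, and later moves
    overwrite the rest. *)
Definition join_clique (e : rel nat) (b : nat) (X : seq nat) : rel nat :=
  fun s t => if t < b then e s t else (s < b) ==> (s \in X).

Lemma agree_join_clique e b X : agree b e (join_clique e b X).
Proof. by move=> x y xy yb; rewrite /join_clique yb. Qed.

Lemma symadj_join_clique e b X x y :
  symadj (join_clique e b X) x y =
    if x < b then if y < b then symadj e x y else x \in X
    else if y < b then y \in X else x != y.
Proof.
rewrite /symadj /join_clique.
case: (ltngtP x y) => [xy|yx|<-] /=; last by case: (x < b); rewrite ?eqxx ?ltnn.
- case: (ltnP y b) => yb; first by rewrite (ltn_trans xy yb) orbF.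
  by case: (ltnP x b) => xb; rewrite ?orbF.
- case: (ltnP x b) => xb; first by rewrite (ltn_trans yx xb).
  by case: (ltnP y b) => yb.
Qed.

(* The old block exchanges the colors below [h] with those in [h, 2h), so that
   the new clique can take the colors below [h]. *)
Lemma block_join_clique e a b X c r : h.*2 <= d -> block e a b X c r ->
  block (join_clique e b X) a (b + h) (iota b h)
    (fun x => if x < b then
                if c x < h then c x + h else if c x < h.*2 then c x - h else c x
              else x - b)
    (fun x => if x < b then r x + h else x - b).
Proof.
move=> hd [le sep bd pr rk peo sub sm ini].
have E := symadj_join_clique e b X.
have NX x : x < a -> (x \in X) = false.
  by move=> xa; apply/negP => /sub; lia.
split.
- lia.
- move=> x y xa yab; rewrite E (leq_trans xa le) NX //.
  by case: ltnP => // yb; apply: sep => //; lia.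
- move=> x xab; case: (ltnP x b) => xb; last by lia.
  have : c x < d by apply: bd; lia.
  by case: ifP => ?; [lia|case: ifP => ?; lia].
- move=> x y xab yab; rewrite E.
  case: (ltnP x b) => xb; case: (ltnP y b) => yb.
  + move=> xy; have : c x != c y by apply: pr => //; lia.
    case: (ltnP (c x) h) => cx; case: (ltnP (c y) h) => cy;
      do ?[case: ltnP => ?]; lia.
  + by move=> /sm cx; rewrite cx; lia.
  + by move=> /sm cy; rewrite cy; lia.
  + by lia.
- move=> x y xab yab; rewrite E.
  case: (ltnP x b) => xb; case: (ltnP y b) => yb; try by lia.
  by move=> xy; have : r x != r y by [apply: rk => //; lia]; lia.
- move=> x y z xab yab zab; rewrite !E.
  case: (ltnP x b) => xb; case: (ltnP y b) => yb; case: (ltnP z b) => zb //;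
    try by lia.
  + by move=> yx zx ry rz yz; apply: (peo x) => //; lia.
  (* The clique ranks below all old vertices. An old [x] with a clique neighbor is in [X], and
     [block_initial] puts its lower old neighbor in [X] too, hence next to the clique. *)
  + by move=> yx xX ry rz _; apply: ini yx _ => //; lia.
  + by move=> xX zx ry rz _; apply: ini zx _ => //; lia.
- by move=> x; rewrite mem_iota; lia.
- by move=> x; rewrite mem_iota => xb; case: (ltnP x b); lia.
- move=> x y; rewrite !mem_iota E => xb yab.
  have -> : (x < b) = false by lia.
  by case: (ltnP y b); lia.
Qed.

(** * The inductive strategy of the adversary *)

Lemma exists_block (A : online_algorithm) g e a k :
  g.*2 <= h.+1 -> h.*2 <= d ->
  exists (e' : rel nat) b X c r,
    [/\ agree a e e', block e' a b X c r, b <= a + h * (2 ^ k - 1)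
      & g * k <= size (undup (map (col A e') X))].
Proof.
move=> gh hd; elim: k e a => [|k IH] e a.
  exists e, a, [::], id, id; split=> //; [exact: block_empty|lia|lia].
have [e1 [b1 [X1 [c1 [r1 [ag1 B1 le1 nc1]]]]]] := IH e a.
have [e2 [b2 [X2 [c2 [r2 [ag2 B2 le2 nc2]]]]]] := IH e1 b1.
have leb1 := block_le B1; have leb2 := block_le B2.
(* Two plays and one clique: [2 * (2 ^ k - 1) + 1 = 2 ^ k.+1 - 1]. *)
have le2k : b2 + h <= a + h * (2 ^ k.+1 - 1).
  by rewrite expnS; have := expn_gt0 2 k; nia.
have X1b x : x \in X1 -> x < b1 by move/(block_sub B1)/andP => [].
have X2b x : x \in X2 -> x < b2 by move/(block_sub B2)/andP => [].
have {}B1 := block_agree ag2 B1.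
rewrite -(agree_map_col A ag2 X1b) in nc1.
rewrite mulnSr.
case: (leqP (g * k + g) (size (undup (map (col A e2) (X1 ++ X2))))) => nc.
  exists e2, b2, (X1 ++ X2); do 2 eexists; split; first 1 last.
  - exact: block_cat B1 B2.
  - lia.
  - exact: nc.
  - exact: agree_trans leb1 ag1 ag2.
pose e3 := join_clique e2 b2 X2.
have ag3 : agree b2 e2 e3 by exact: agree_join_clique.
have ag31 : agree b1 e2 e3 by move=> x y xy yb; apply: ag3 => //; lia.
have B3 := block_join_clique hd B2.
(* [X2] is dropped: its block now offers only the clique to later joins. *)
exists e3, (b2 + h), (X1 ++ iota b2 h); do 2 eexists; split; first 1 last.
- by apply: block_cat B3; apply: block_agree B1.
- exact: le2k.
- rewrite map_cat (agree_map_col A ag31 X1b).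
  apply: leq_size_undup_cat_disjoint nc1 nc2 _.
  + rewrite map_inj_in_uniq ?iota_uniq // => x y.
    rewrite !mem_iota => xb yb; apply: contra_eq => xy.
    apply: col_proper; rewrite symadj_join_clique.
    have -> : (x < b2) = false by lia.
    by have -> : (y < b2) = false by lia.
  + move=> _ /mapP[x xb ->]; rewrite -(agree_map_col A ag3 X2b).
    apply/mapP => -[y yX]; apply/eqP; apply: col_proper.
    have xF : (x < b2) = false by move: xb; rewrite mem_iota; lia.
    by rewrite symadj_join_clique xF (X2b y).
  + by rewrite size_map size_iota.
  + by rewrite -map_cat.
- by apply: (agree_trans leb1 _ ag31); apply: agree_trans leb1 ag1 ag2.
Qed.

(** * Filling up with a [d]-clique and isolated vertices *)

Definition add_clique (e : rel nat) (b : nat) : rel nat :=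
  fun s t => if t < b then e s t else (b <= s) && (t < b + d).

Lemma agree_add_clique e b : agree b e (add_clique e b).
Proof. by move=> x y xy yb; rewrite /add_clique yb. Qed.

Lemma symadj_add_clique e b x y : b <= y ->
  symadj (add_clique e b) x y = [&& b <= x, x < b + d, y < b + d & x != y].
Proof.
move=> yb; rewrite /symadj /add_clique (ltnNge y) yb /=.
case: (ltngtP x y) => xy //=; last by rewrite !andbF.
  by case: (leqP b x) => xb //=; lia.
have -> : (x < b) = false by lia.
by lia.
Qed.

Lemma block_add_clique e b n : 0 < d -> b <= n ->
  block (add_clique e b) b n [::]
    (fun x => if x < b + d then x - b else 0) id.
Proof.
move=> d0 bn; split=> //.
- by move=> x y xb /andP[yb _]; rewrite symadj_add_clique //; lia.
- by move=> x xb; case: (ltnP x (b + d)); lia.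
- move=> x y xb /andP[yb _]; rewrite symadj_add_clique //.
  by case/and4P=> _ xd yd xy; rewrite xd yd; lia.
- by move=> x y xb /andP[yb _]; rewrite symadj_add_clique //; lia.
- move=> x y z /andP[xb _] /andP[yb _] /andP[zb _].
  by rewrite !symadj_add_clique //; lia.
Qed.

Lemma block_colorable e n X c r : block e 0 n X c r -> colorable (graph_of e n) d.
Proof.
move=> B; apply/existsP.
exists [ffun x : 'I_n => Ordinal (block_bound B (ltn_ord x))].
apply/forallP=> x; apply/forallP=> y; apply/implyP=> xy; rewrite !ffunE.
by rewrite -val_eqE /=; apply: (block_proper B) xy; rewrite ltn_ord.
Qed.

Lemma block_chordal e n X c r : block e 0 n X c r -> chordal (graph_of e n).
Proof.
move=> B; apply: (perfect_elimination_chordal (r := fun x : 'I_n => r x)).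
  by move=> x y xy; apply: (block_rank B) xy; rewrite ltn_ord.
move=> x y z yx zx ry rz yz.
by apply: (block_peo B) yx zx ry rz _; rewrite ?ltn_ord ?val_eqE.
Qed.

End Blocks.

(** * Chromatic number, estimates and conclusion *)

Lemma clique_leq_colorable (V : finType) (G : sgraph V) k d (f : 'I_d -> V) :
  (forall i j, i != j -> G (f i) (f j)) -> colorable G k -> d <= k.
Proof.
move=> Gf /existsP[c /forallP cP].
have := @leq_card _ _ (fun i => c (f i)); rewrite !card_ord; apply=> i j.
apply: contra_eq => /Gf ij; have /forallP/(_ (f j))/implyP := cP (f i).
exact.
Qed.

Lemma chi_eq (V : finType) (G : sgraph V) d (f : 'I_d -> V) :
  (forall i j, i != j -> G (f i) (f j)) -> colorable G d -> chi G = d.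
Proof.
move=> Gf Gd; rewrite /chi; case: ex_minnP => m Gm minm.
by apply/eqP; rewrite eqn_leq minm // (clique_leq_colorable Gf Gm).
Qed.

(** Squaring [n < d * 2 ^ k.+1] and using [d ^ 2 <= n / 2] gives [n < 2 ^ (2 * k + 1)], and
    [k >= 1]. *)
Lemma ltn_exp2_trunc_log d n : 1 < d -> 2 * d ^ 2 <= n ->
  n < 2 ^ (3 * trunc_log 2 (n %/ d)).
Proof.
move=> d2 dn; set k := trunc_log 2 (n %/ d).
have dn4 : 4 <= n %/ d by rewrite leq_divRL; nia.
have k1 : 0 < k by rewrite trunc_log_gt0; lia.
have nd : n < d * 2 ^ k.+1.
  by rewrite mulnC -ltn_divLR ?trunc_log_ltn //; lia.
have : n < 2 ^ (2 * k + 1).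
  have E : 2 * 2 ^ (2 * k + 1) = 2 ^ k.+1 * 2 ^ k.+1.
    by rewrite -expnS -expnD; congr (_ ^ _); lia.
  have E2 : n * n < d * 2 ^ k.+1 * (d * 2 ^ k.+1) by exact: ltn_mul.
  move: E E2; set P := 2 ^ k.+1; set Q := 2 ^ _ => E E2; nia.
by move=> /leq_trans; apply; rewrite leq_exp2l //; lia.
Qed.

Lemma log2_natr_le (R : realType) n m : 0 < n -> n <= 2 ^ m ->
  (log2 (n%:R : R) <= m%:R)%R.
Proof.
move=> n0 nm; have ln2 : (0 < ln 2 :> R)%R by rewrite ln_gt0 // ltr1n.
rewrite /log2 ler_pdivrMr // mulr_natl -lnXn // ler_ln ?posrE ?ltr0n //.
  by rewrite -natrX ler_nat.
by rewrite exprn_gt0.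
Qed.

Theorem theorem1 (R : realType) :
  exists2 c : R, (0 < c)%R &
    forall d : nat, 2 <= d ->
    forall (A : online_algorithm) (n : nat), 2 * d ^ 2 <= n ->
      exists (G : sgraph 'I_n) (v : 'S_n),
        [/\ chordal G, chi G = d &
          (c * (d%:R * log2 (n%:R : R)) <= (colors_used A G v)%:R)%R].
Proof.
(* 15 = 3 * 5, from [log2 n <= 3 * k] and [d <= 5 * g]. *)
exists (15%:R^-1)%R; first by rewrite invr_gt0 ltr0n.
move=> d d2 A n dn.
(* The largest [g] with [2 * (2 * g - 1) <= d]; it is positive since [d >= 2]. *)
pose g := (d + 2) %/ 4; pose h := g.*2.-1; pose k := trunc_log 2 (n %/ d).
have gh : g.*2 <= h.+1 by rewrite /h; lia.
have hd : h.*2 <= d by rewrite /h /g; lia.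
have [e [b [X [c [r [_ B le_b nc]]]]]] :=
  exists_block A (fun _ _ => false) 0 k gh hd.
(* As [h <= d], [h * (2 ^ k - 1) + d <= d * 2 ^ k <= n], which leaves room for the [d]-clique. *)
have bdn : b + d <= n.
  have dnd : 0 < n %/ d by rewrite divn_gt0; nia.
  have : d * 2 ^ k <= n.
    have := leq_divM n d; have := trunc_logP (isT : 1 < 2) dnd; rewrite -/k; nia.
  have := expn_gt0 2 k; nia.
have bn : b <= n by lia.
have B' := block_cat (block_agree (@agree_add_clique d e b) B)
  (block_add_clique (d := d) h e (ltnW d2) bn).
pose G := graph_of (add_clique d e b) n; exists G, 1%g; split.
- exact: block_chordal B'.
- have lt_n (i : 'I_d) : b + i < n by have := ltn_ord i; lia.
  apply: (chi_eq (f := fun i => Ordinal (lt_n i))).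
    move=> i j; rewrite -val_eqE /= symadj_add_clique ?leq_addr //.
    by have := ltn_ord i; have := ltn_ord j; lia.
  exact: block_colorable B'.
have Xb x : x \in X -> x < b by move/(block_sub B)/andP => [].
have used : g * k <= colors_used A G 1.
  rewrite -(agree_map_col A (@agree_add_clique d e b) Xb) in nc.
  apply: leq_trans nc _; apply: leq_colors_used => x /Xb; lia.
have n0 : 0 < n by nia.
have logn := log2_natr_le R n0 (ltnW (ltn_exp2_trunc_log d2 dn)).
rewrite mulrC ler_pdivrMr ?ltr0n //.
apply: (@le_trans _ _ (d%:R * (3 * k)%:R)%R); first by rewrite ler_wpM2l.
rewrite -!natrM ler_nat; apply: leq_trans (_ : g * k * 15 <= _); last by nia.
have : d <= 5 * g by rewrite /g; lia.
nia.
Qed.
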